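(* Let $R$ be a ring and $\sigma$ an endomorphism of $R$ such that $R$ is $\sigma$-compatible. Then: (1) The following are equivalent: $R$ is right idempotent reflexive; $R[x;\sigma]$ is right idempotent reflexive; $R[[x;\sigma]]$ is right idempotent reflexive. (2) The following are equivalent: $R$ is left idempotent reflexive; $R[x;\sigma]$ is left idempotent reflexive; $R[[x;\sigma]]$ is left idempotent reflexive. (3) The following are equivalent: $R$ is idempotent reflexive; $R[x;\sigma]$ is idempotent reflexive; $R[[x;\sigma]]$ is idempotent reflexive.
   Context: Rings are associative with unity. For an endomorphism $\sigma$ of $R$, the ring $R$ is called $\sigma$-compatible if for all $a,b\in R$, $ab=0$ if and only if $a\sigma(b)=0$. A ring $S$ is called left idempotent reflexive if for all $a\in S$ and all idempotents $e=e^2\in S$, $eSa=0$ implies $aSe=0$; it is called right idempotent reflexive if for all $a\in S$ and all idempotents $e=e^2\in S$, $aSe=0$ implies $eSa=0$; it is called idempotent reflexive if it is both left and right idempotent reflexive. The skew polynomial ring $R[x;\sigma]$ is the set of polynomials $\sum_{i=0}^n a_ix^i$ with coefficients $a_i\in R$ written on the left, with usual addition and with multiplication determined by $xr=\sigma(r)x$ for all $r\in R$. The skew power series ring $R[[x;\sigma]]$ consists of all power series $\sum_{i=0}^\infty a_ix^i$ ($a_i\in R$), multiplied using the distributive law and the rule $xr=\sigma(r)x$ for all $r\in R$. *)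

(* Defs.v *)
From HB Require Import structures.
From mathcomp Require Import all_boot all_algebra.
From mathcomp Require Import boolp.

Set Implicit Arguments.
Unset Strict Implicit.
Unset Printing Implicit Defensive.

Import GRing.Theory.
Local Open Scope ring_scope.

(* The zero ring is allowed: rings are [pzRingType]s. *)

Definition right_idempotent_reflexive (S : pzRingType) : Prop :=
  forall a e : S, e * e = e ->
    (forall s : S, a * s * e = 0) -> (forall s : S, e * s * a = 0).

Definition left_idempotent_reflexive (S : pzRingType) : Prop :=
  forall a e : S, e * e = e ->
    (forall s : S, e * s * a = 0) -> (forall s : S, a * s * e = 0).

Definition idempotent_reflexive (S : pzRingType) : Prop :=
  left_idempotent_reflexive S /\ right_idempotent_reflexive S.

Definition compatible (R : pzRingType) (sigma : R -> R) : Prop :=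
  forall a b : R, a * b = 0 <-> a * sigma b = 0.

(* [SkewSeries a : skew_series sigma] is the series \sum_i a_i x^i of
   R[[x; sigma]]; [sigma] is a phantom parameter that selects the product. *)
Record skew_series (R : pzRingType) (sigma : {rmorphism R -> R}) : Type :=
  SkewSeries { scoef : nat -> R }.

Arguments SkewSeries {R} sigma scoef.

Section SkewSeriesRing.
Variables (R : pzRingType) (sigma : {rmorphism R -> R}).
Implicit Types f g h : skew_series sigma.

HB.instance Definition _ := gen_eqMixin (skew_series sigma).
HB.instance Definition _ := gen_choiceMixin (skew_series sigma).

Definition sseries0 := SkewSeries sigma (fun _ => 0).
Definition sseries_opp f := SkewSeries sigma (fun n => - scoef f n).
Definition sseries_add f g :=
  SkewSeries sigma (fun n => scoef f n + scoef g n).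

Definition sseriesC (a : R) :=
  SkewSeries sigma (fun n => if n == 0%N then a else 0).
Definition sseriesX := SkewSeries sigma (fun n => (n == 1%N)%:R).

(* (a x^i) (b x^j) = a sigma^i(b) x^(i+j) *)
Definition sseries_mul f g :=
  SkewSeries sigma
    (fun n => \sum_(i < n.+1) scoef f i * iter i sigma (scoef g (n - i)%N)).

Lemma sseriesP f g : (forall n, scoef f n = scoef g n) <-> f = g.
Proof.
split=> [|-> //]; case: f g => [a] [b] /= ab.
by congr SkewSeries; apply/funext.
Qed.

Lemma iter_sigma0 n : iter n sigma 0 = 0.
Proof. by elim: n => //= n ->; rewrite rmorph0. Qed.
Lemma iter_sigma1 n : iter n sigma 1 = 1.
Proof. by elim: n => //= n ->; rewrite rmorph1. Qed.
Lemma iter_sigmaD n : {morph iter n sigma : a b / a + b}.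
Proof. by move=> a b; elim: n => //= n ->; rewrite rmorphD. Qed.
Lemma iter_sigmaM n : {morph iter n sigma : a b / a * b}.
Proof. by move=> a b; elim: n => //= n ->; rewrite rmorphM. Qed.
Lemma iter_sigma_sum n I (r : seq I) (P : pred I) (F : I -> R) :
  iter n sigma (\sum_(i <- r | P i) F i) =
  \sum_(i <- r | P i) iter n sigma (F i).
Proof. exact: (big_morph _ (iter_sigmaD n) (iter_sigma0 n)). Qed.

Fact sseries_addA : associative sseries_add.
Proof. by move=> f g h; apply/sseriesP => n /=; rewrite addrA. Qed.
Fact sseries_addC : commutative sseries_add.
Proof. by move=> f g; apply/sseriesP => n /=; rewrite addrC. Qed.
Fact sseries_add0 : left_id sseries0 sseries_add.
Proof. by move=> f; apply/sseriesP => n /=; rewrite add0r. Qed.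
Fact sseries_addN : left_inverse sseries0 sseries_opp sseries_add.
Proof. by move=> f; apply/sseriesP => n /=; rewrite addNr. Qed.

HB.instance Definition _ := GRing.isZmodule.Build (skew_series sigma)
  sseries_addA sseries_addC sseries_add0 sseries_addN.

Fact sseries_mulA : associative sseries_mul.
Proof.
move=> f g h; apply/sseriesP => n /=.
pose c3 i j := scoef f i *
  (iter i sigma (scoef g (j - i)%N) * iter j sigma (scoef h (n - j)%N)).
transitivity (\sum_(i < n.+1) \sum_(j < n.+1 | (i <= j)%N) c3 i j).
  apply: eq_bigr => i _; rewrite iter_sigma_sum big_distrr /=.
  rewrite -(big_mkord xpredT (fun k => scoef f i * iter i sigma
    (scoef g k * iter k sigma (scoef h (n - i - k)%N)))).
  rewrite -(big_mkord (fun j => (i <= j)%N) (fun j => c3 i j)).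
  have lein : (i <= n.+1)%N by apply: ltnW.
  rewrite [RHS](big_cat_nat (n := i)) ?lein //=.
  rewrite [X in _ = X + _]big1_seq ?add0r => [|j /andP[ij]]; last first.
    by rewrite mem_index_iota /= ltnNge ij.
  have -> : \sum_(i <= j < n.+1 | (i <= j)%N) c3 i j =
            \sum_(i <= j < n.+1) c3 i j.
    rewrite big_nat_cond [RHS]big_nat_cond; apply: eq_bigl => j.
    by case: (i <= j)%N; rewrite ?andbT.
  have := big_addn 0 n.+1 i xpredT (c3 i).
  rewrite add0n subSn ?leq_ord //= => ->.
  apply: eq_bigr => k _; rewrite /c3 iter_sigmaM -iterD addnK.
  by rewrite [(i + k)%N]addnC subnDA subnAC.
rewrite (exchange_big_dep xpredT) //=; apply: eq_bigr => j _.
rewrite big_distrl /= (big_ord_narrow_leq (leq_ord j)) /=.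
by apply: eq_bigr => i _; rewrite /c3 mulrA.
Qed.

Fact sseries_mul1l : left_id (sseriesC 1) sseries_mul.
Proof.
move=> f; apply/sseriesP => n /=; rewrite big_ord_recl /= subn0 mul1r.
by rewrite big1 ?addr0 // => i _; rewrite mul0r.
Qed.
Fact sseries_mul1r : right_id (sseriesC 1) sseries_mul.
Proof.
move=> f; apply/sseriesP => n /=; rewrite big_ord_recr /= subnn /=.
rewrite iter_sigma1 mulr1 big1 ?add0r // => i _.
by rewrite subn_eq0 leqNgt ltn_ord /= iter_sigma0 mulr0.
Qed.
Fact sseries_mulDl : left_distributive sseries_mul sseries_add.
Proof.
move=> f g h; apply/sseriesP => n /=; rewrite -big_split.
by apply: eq_bigr => i _; rewrite mulrDl.
Qed.
Fact sseries_mulDr : right_distributive sseries_mul sseries_add.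
Proof.
move=> f g h; apply/sseriesP => n /=; rewrite -big_split.
by apply: eq_bigr => i _; rewrite iter_sigmaD mulrDr.
Qed.

HB.instance Definition _ := GRing.Zmodule_isPzRing.Build (skew_series sigma)
  sseries_mulA sseries_mul1l sseries_mul1r sseries_mulDl sseries_mulDr.

Lemma scoef0 n : scoef (0 : skew_series sigma) n = 0.
Proof. by []. Qed.
Lemma scoef1 n : scoef (1 : skew_series sigma) n = if n == 0%N then 1 else 0.
Proof. by []. Qed.
Lemma scoefN f n : scoef (- f) n = - scoef f n.
Proof. by []. Qed.
Lemma scoefD f g n : scoef (f + g) n = scoef f n + scoef g n.
Proof. by []. Qed.
Lemma scoefM f g n :
  scoef (f * g) n =
  \sum_(i < n.+1) scoef f i * iter i sigma (scoef g (n - i)%N).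
Proof. by []. Qed.
Lemma scoef_sum I (r : seq I) (P : pred I) (F : I -> skew_series sigma) n :
  scoef (\sum_(i <- r | P i) F i) n = \sum_(i <- r | P i) scoef (F i) n.
Proof. exact: (big_morph (fun f => scoef f n)). Qed.

Lemma scoefCM a f n : scoef (sseriesC a * f) n = a * scoef f n.
Proof.
rewrite scoefM big_ord_recl /= subn0 big1 ?addr0 // => i _.
by rewrite mul0r.
Qed.

Lemma scoefXn m n : scoef (sseriesX ^+ m) n = (n == m)%:R.
Proof.
elim: m n => [|m IHm] n; first by rewrite expr0 scoef1; case: (n == 0%N).
rewrite exprS scoefM; case: n => [|n].
  by rewrite big_ord_recl big_ord0 /= mul0r addr0.
rewrite big_ord_recl big_ord_recl /= mul0r add0r mul1r big1 ?addr0.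
  by rewrite IHm subn1 eqSS; case: eqP; rewrite /= ?rmorph0 ?rmorph1.
by move=> i _; rewrite mul0r.
Qed.

Lemma sseriesXC a : sseriesX * sseriesC a = sseriesC (sigma a) * sseriesX.
Proof.
apply/sseriesP => n; rewrite scoefCM scoefM; case: n => [|n].
  by rewrite big_ord_recl big_ord0 /= mul0r addr0 mulr0.
rewrite big_ord_recl big_ord_recl /= mul0r add0r mul1r big1 ?addr0.
  by rewrite subn1 /=; case: n => [|n]; rewrite ?mulr1 ?rmorph0 ?mulr0.
by move=> i _; rewrite mul0r.
Qed.

(* R[x; sigma] is realised as the subring of R[[x; sigma]] of the series with
   finitely many nonzero coefficients. *)
Definition finite_series : {pred skew_series sigma} :=
  fun f => `[< exists n, forall i, (n <= i)%N -> scoef f i = 0 >].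

Lemma finite_seriesP f :
  reflect (exists n, forall i, (n <= i)%N -> scoef f i = 0)
          (f \in finite_series).
Proof. exact: asboolP. Qed.

Fact finite_series_subring : subring_closed finite_series.
Proof.
split.
- by apply/finite_seriesP; exists 1%N; case.
- move=> f g /finite_seriesP[m f0] /finite_seriesP[n g0].
  apply/finite_seriesP; exists (maxn m n) => i.
  by rewrite geq_max => /andP[mi ni]; rewrite scoefD scoefN f0 ?g0 // subrr.
- move=> f g /finite_seriesP[m f0] /finite_seriesP[n g0].
  apply/finite_seriesP; exists (m + n)%N => i mni.
  rewrite scoefM big1 // => j _; case: (leqP m j) => [mj|jm].
    by rewrite f0 // mul0r.
  rewrite g0 ?iter_sigma0 ?mulr0 // -(leq_add2r j) subnK ?leq_ord //.
  by rewrite (leq_trans _ mni) // addnC leq_add2r ltnW.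
Qed.

HB.instance Definition _ := GRing.isSubringClosed.Build (skew_series sigma)
  finite_series finite_series_subring.

End SkewSeriesRing.

Record skew_poly (R : pzRingType) (sigma : {rmorphism R -> R}) : Type :=
  SkewPoly {
    skew_poly_series :> skew_series sigma;
    skew_poly_finite : skew_poly_series \in @finite_series R sigma }.

Section SkewPolyRing.
Variables (R : pzRingType) (sigma : {rmorphism R -> R}).

HB.instance Definition _ := [isSub for @skew_poly_series R sigma].
HB.instance Definition _ := [Choice of skew_poly sigma by <:].
HB.instance Definition _ :=
  GRing.SubChoice_isSubPzRing.Build (skew_series sigma)
    (@finite_series R sigma) (skew_poly sigma)
    (@finite_series_subring R sigma).

Lemma skew_polyD (f g : skew_poly sigma) :
  skew_poly_series (f + g) = skew_poly_series f + skew_poly_series g.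
Proof. exact: (raddfD (val : skew_poly sigma -> skew_series sigma)). Qed.
Lemma skew_polyM (f g : skew_poly sigma) :
  skew_poly_series (f * g) = skew_poly_series f * skew_poly_series g.
Proof. exact: (rmorphM (val : skew_poly sigma -> skew_series sigma)). Qed.
Lemma skew_poly0 : skew_poly_series (0 : skew_poly sigma) = 0.
Proof. exact: (raddf0 (val : skew_poly sigma -> skew_series sigma)). Qed.
Lemma skew_poly1 : skew_poly_series (1 : skew_poly sigma) = 1.
Proof. exact: (rmorph1 (val : skew_poly sigma -> skew_series sigma)). Qed.

Lemma skew_polyE (f : skew_poly sigma) :
  exists n, (f : skew_series sigma) =
    \sum_(i < n) sseriesC sigma (scoef f i) * sseriesX sigma ^+ i.
Proof.
have /finite_seriesP[n f0] := skew_poly_finite f.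
exists n; apply/sseriesP => k; rewrite scoef_sum.
under eq_bigr do rewrite scoefCM scoefXn.
case: (ltnP k n) => [kn|nk].
  rewrite (bigD1 (Ordinal kn)) //= eqxx mulr1 big1 ?addr0 // => i.
  by rewrite -val_eqE eq_sym /= => /negbTE->; rewrite mulr0.
rewrite f0 // big1 // => i _.
by rewrite gtn_eqF ?mulr0 // (leq_trans (ltn_ord i)).
Qed.

End SkewPolyRing.

(* Main.v *)
Require Import Defs.
From mathcomp Require Import all_boot all_algebra.

Set Implicit Arguments.
Unset Strict Implicit.
Unset Printing Implicit Defensive.

Import GRing.Theory.
Local Open Scope ring_scope.

(** Write S for R[x; sigma] and T for R[[x; sigma]]. The difficulty is that an
    idempotent of T need not be a constant; over a matrix ring, for instance,
    conjugation by 1 + a x produces many that are not. But an idempotent is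
    determined up to conjugacy by its constant term. If e and e' are idempotents
    with e_0 = e'_0, then u = e e' + (1 - e)(1 - e') satisfies e u = u e', and
    u_0 = e_0 + (1 - e_0) = 1, so that u is invertible by the geometric series.
    Hence e and its constant term e_0
    generate the same two-sided ideal of T, and in the conditions f T e = 0 and
    e T f = 0 one may replace e by e_0 ([idem_cst_factor]).

    For a constant c, compatibility strips all powers of sigma from the
    coefficients of f s c and c s f: f T c = 0 means f_i R c = 0 for all i, and
    c T f = 0 means c R f_i = 0 for all i. Together, for an idempotent e of T,
      f T e = 0 iff f_i R e_0 = 0 for all i, and
      e T f = 0 iff e_0 R f_i = 0 for all i
    ([annihilates_idemr], [annihilates_ideml]), so that both one-sided
    conditions lift from R to T.

    Finally, for f and g in S, f S g = 0 iff f T g = 0, because the n-th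
    coefficient of f s g sees only the coefficients of s up to n
    ([annihilates_poly]). The conditions thus restrict from T to S, and
    from S to R by means of constant polynomials. *)

(** * Two-sided annihilation *)

Definition annihilates (S : pzRingType) (a b : S) : Prop :=
  forall s : S, a * s * b = 0.

Lemma annihilates_factorr (S : pzRingType) (a b u v : S) :
  annihilates a b -> annihilates a (u * b * v).
Proof. by move=> ab s; rewrite !mulrA -(mulrA a) ab mul0r. Qed.

Lemma annihilates_factorl (S : pzRingType) (a b u v : S) :
  annihilates a b -> annihilates (u * a * v) b.
Proof. by move=> ab s; rewrite -!mulrA (mulrA v) (mulrA a) ab mulr0. Qed.

(** * Invertible series and idempotents *)

Section Series.
Variables (R : pzRingType) (sigma : {rmorphism R -> R}).
Implicit Types (f g s u e : skew_series sigma) (a c r : R).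

(** Multiplication is continuous for the x-adic topology, with modulus the
    identity. *)
Lemma eq_scoefM n f f' g g' :
    (forall i, (i <= n)%N -> scoef f i = scoef f' i) ->
    (forall i, (i <= n)%N -> scoef g i = scoef g' i) ->
  scoef (f * g) n = scoef (f' * g') n.
Proof.
move=> ff' gg'; rewrite !scoefM; apply: eq_bigr => i _.
by rewrite ff' ?leq_ord // gg' ?leq_subr.
Qed.

Lemma scoefM0 f g : scoef (f * g) 0 = scoef f 0 * scoef g 0.
Proof. by rewrite scoefM big_ord_recl big_ord0 addr0. Qed.

Lemma idem_scoef0 e : e * e = e -> scoef e 0 * scoef e 0 = scoef e 0.
Proof. by move=> ee; rewrite -scoefM0 ee. Qed.

Lemma scoef_expr_small g k n :
  scoef g 0 = 0 -> (n < k)%N -> scoef (g ^+ k) n = 0.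
Proof.
move=> g0; elim: k n => // k IHk n; rewrite ltnS => nk.
rewrite exprS scoefM big_ord_recl g0 mul0r add0r big1 // => i _.
rewrite IHk ?iter_sigma0 ?mulr0 // (leq_trans _ nk) // lift0.
by rewrite subnS prednK ?subn_gt0 // leq_subr.
Qed.

(** The inverse is the geometric series \sum_k (1 - u)^k, which converges
    because its k-th term has order at least k. *)
Lemma unipotent_right_inverse u : scoef u 0 = 1 -> exists v, u * v = 1.
Proof.
move=> u0; pose g := 1 - u.
have g0 : scoef g 0 = 0 by rewrite scoefD scoefN u0 subrr.
pose geom n := \sum_(k < n) g ^+ k.
have geomE n i : (i <= n)%N -> scoef (geom i.+1) i = scoef (geom n.+1) i.
  move=> le_in; rewrite !scoef_sum.
  rewrite -!(big_mkord xpredT (fun k => scoef (g ^+ k) i)).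
  rewrite [RHS](big_cat_nat (n := i.+1)) //=.
  rewrite [X in _ = _ + X]big_nat_cond [X in _ = _ + X]big1 ?addr0 //.
  by move=> k /andP[/andP[ik _] _]; rewrite scoef_expr_small.
exists (SkewSeries sigma (fun n => scoef (geom n.+1) n)).
apply/sseriesP => n.
rewrite (@eq_scoefM n u u _ (geom n.+1)) //; last exact: geomE.
have -> : u * geom n.+1 = 1 - g ^+ n.+1.
  by rewrite -opprB subrX1 -mulNr opprB /g subKr.
by rewrite scoefD scoefN scoef_expr_small // subr0.
Qed.

(** The unit u = e e' + (1 - e)(1 - e') intertwines e and e', and has constant
    term 1. The conclusion puts e in the ideal generated by e'; exchanging the
    two shows that they generate the same ideal. *)
Lemma idem_cst_factor e e' :
    e * e = e -> e' * e' = e' -> scoef e 0 = scoef e' 0 ->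
  exists u v, e = u * e' * v.
Proof.
move=> ee e'e' e0; pose u := e * e' + (1 - e) * (1 - e').
have eu : e * u = u * e'.
  rewrite /u [LHS]mulrDr [RHS]mulrDl !mulrA [e * (1 - e)]mulrBr mulr1 ee subrr.
  by rewrite mul0r addr0 -!mulrA e'e' [(1 - e') * e']mulrBl mul1r e'e' subrr
    mulr0 addr0.
have [|v uv] := @unipotent_right_inverse u.
  have idem0 := idem_scoef0 e'e'.
  rewrite scoefD !scoefM0 !scoefD !scoefN scoef1 /= e0 idem0.
  by rewrite mulrBl mul1r mulrBr mulr1 idem0 subrr subr0 addrC subrK.
by exists u, v; rewrite -eu -mulrA uv mulr1.
Qed.

Lemma scoefMC f c n :
  scoef (f * sseriesC sigma c) n = scoef f n * iter n sigma c.
Proof.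
rewrite scoefM big_ord_recr /= subnn /= big1 ?add0r // => i _.
by rewrite subn_eq0 leqNgt ltn_ord /= iter_sigma0 mulr0.
Qed.

Lemma sseriesCM a c :
  sseriesC sigma (a * c) = sseriesC sigma a * sseriesC sigma c.
Proof.
by apply/sseriesP => n; rewrite scoefCM /=; case: eqP; rewrite ?mulr0.
Qed.

Lemma idem_cst e : e * e = e ->
  sseriesC sigma (scoef e 0) * sseriesC sigma (scoef e 0)
    = sseriesC sigma (scoef e 0).
Proof. by move=> ee; rewrite -sseriesCM idem_scoef0. Qed.

Lemma sseriesC_finite c : sseriesC sigma c \in @finite_series R sigma.
Proof. by apply/finite_seriesP; exists 1%N; case. Qed.

(** * Annihilation read off the coefficients *)

Hypothesis sigma_compat : compatible sigma.

Lemma compatible_iter n a c : a * c = 0 <-> a * iter n sigma c = 0.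
Proof. by elim: n => //= n IHn; apply: (iff_trans IHn); apply: sigma_compat. Qed.

(** Testing f s c = 0 on the constants s = r gives f_i sigma^i(r c) = 0, that
    is, f_i r c = 0. Conversely the n-th coefficient of f s c is
    (f s)_n sigma^n(c), and (f s)_n is a sum of terms in f_i R. *)
Lemma annihilates_cstr f c :
  annihilates f (sseriesC sigma c) <-> forall i, annihilates (scoef f i) c.
Proof.
split=> [fc i r|fc s].
  have /sseriesP/(_ i) := fc (sseriesC sigma r).
  rewrite -mulrA -sseriesCM scoefMC => /(proj2 (compatible_iter _ _ _)).
  by rewrite mulrA.
apply/sseriesP => n; rewrite scoefMC; apply/(proj1 (compatible_iter _ _ _)).
rewrite scoefM big_distrl big1 // => i _; exact: fc.
Qed.

Lemma annihilates_cstl f c :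
  annihilates (sseriesC sigma c) f <-> forall i, annihilates c (scoef f i).
Proof.
split=> [cf i r|cf s].
  by have /sseriesP/(_ i) := cf (sseriesC sigma r); rewrite -sseriesCM scoefCM.
apply/sseriesP => n; rewrite scoefM big1 // => i _; rewrite scoefCM.
by apply/(proj1 (compatible_iter _ _ _)); exact: cf.
Qed.

Lemma annihilates_idemr f e : e * e = e ->
  annihilates f e <-> forall i, annihilates (scoef f i) (scoef e 0).
Proof.
move=> ee; rewrite -annihilates_cstr; have cc := idem_cst ee.
have [u [v eE]] := idem_cst_factor ee cc erefl.
have [u' [v' cE]] := idem_cst_factor cc ee erefl.
by split=> [fe|fc]; [rewrite cE|rewrite eE]; exact: annihilates_factorr.
Qed.

Lemma annihilates_ideml f e : e * e = e ->
  annihilates e f <-> forall i, annihilates (scoef e 0) (scoef f i).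
Proof.
move=> ee; rewrite -annihilates_cstl; have cc := idem_cst ee.
have [u [v eE]] := idem_cst_factor ee cc erefl.
have [u' [v' cE]] := idem_cst_factor cc ee erefl.
by split=> [fe|fc]; [rewrite cE|rewrite eE]; exact: annihilates_factorl.
Qed.

Lemma annihilatesC a c :
  annihilates (sseriesC sigma a) (sseriesC sigma c) <-> annihilates a c.
Proof.
rewrite annihilates_cstr; split=> [/(_ 0%N)//|ac [//|i] s].
by rewrite /= !mul0r.
Qed.

(** Every series s agrees up to any given degree with a polynomial, its
    truncation, so S is dense enough in T to test annihilation. *)
Lemma annihilates_poly (f g : skew_poly sigma) :
  annihilates f g <->
  annihilates (skew_poly_series f) (skew_poly_series g).
Proof.
split=> [fg s|fg s]; last first.
  by apply: val_inj; rewrite [LHS]skew_polyM skew_polyM fg [RHS]skew_poly0.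
apply/sseriesP => n.
pose t := SkewSeries sigma (fun i => if (i <= n)%N then scoef s i else 0).
have t_fin : t \in @finite_series R sigma.
  by apply/finite_seriesP; exists n.+1 => i ni; rewrite /= leqNgt ni.
have st i : (i <= n)%N -> scoef s i = scoef t i by move=> /= ->.
transitivity (scoef (skew_poly_series f * t * skew_poly_series g) n); last first.
  by rewrite -[t]/(skew_poly_series (SkewPoly t_fin)) -!skew_polyM fg skew_poly0.
apply: eq_scoefM => // i le_in; apply: eq_scoefM => // j le_ji.
exact: st (leq_trans le_ji le_in).
Qed.

(** * Transfer of idempotent reflexivity *)

Lemma right_reflexive_series :
  right_idempotent_reflexive R ->
  right_idempotent_reflexive (skew_series sigma).
Proof.
move=> reflR f e ee /(annihilates_idemr _ ee) fe.
apply/(annihilates_ideml _ ee) => i.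
exact: reflR (idem_scoef0 ee) (fe i).
Qed.

Lemma left_reflexive_series :
  left_idempotent_reflexive R ->
  left_idempotent_reflexive (skew_series sigma).
Proof.
move=> reflR f e ee /(annihilates_ideml _ ee) ef.
apply/(annihilates_idemr _ ee) => i.
exact: reflR (idem_scoef0 ee) (ef i).
Qed.

Lemma right_reflexive_series_poly :
  right_idempotent_reflexive (skew_series sigma) ->
  right_idempotent_reflexive (skew_poly sigma).
Proof.
move=> reflT f e ee /annihilates_poly fe; apply/annihilates_poly.
by apply: reflT fe; rewrite -skew_polyM ee.
Qed.

Lemma left_reflexive_series_poly :
  left_idempotent_reflexive (skew_series sigma) ->
  left_idempotent_reflexive (skew_poly sigma).
Proof.
move=> reflT f e ee /annihilates_poly ef; apply/annihilates_poly.
by apply: reflT ef; rewrite -skew_polyM ee.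
Qed.

Definition skew_polyC c : skew_poly sigma := SkewPoly (sseriesC_finite c).

Lemma skew_polyCM a c : skew_polyC (a * c) = skew_polyC a * skew_polyC c.
Proof. by apply: val_inj; rewrite [RHS]skew_polyM /= sseriesCM. Qed.

Lemma annihilates_polyC a c :
  annihilates (skew_polyC a) (skew_polyC c) <-> annihilates a c.
Proof. by rewrite annihilates_poly annihilatesC. Qed.

Lemma right_reflexive_poly_base :
  right_idempotent_reflexive (skew_poly sigma) ->
  right_idempotent_reflexive R.
Proof.
move=> reflS a e ee /annihilates_polyC ae; apply/annihilates_polyC.
by apply: reflS ae; rewrite -skew_polyCM ee.
Qed.

Lemma left_reflexive_poly_base :
  left_idempotent_reflexive (skew_poly sigma) ->
  left_idempotent_reflexive R.
Proof.
move=> reflS a e ee /annihilates_polyC ea; apply/annihilates_polyC.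
by apply: reflS ea; rewrite -skew_polyCM ee.
Qed.

End Series.

Theorem theorem2p3 (R : pzRingType) (sigma : {rmorphism R -> R})
    (Rsigma : compatible sigma) :
  ((right_idempotent_reflexive R <->
      right_idempotent_reflexive (skew_poly sigma)) /\
   (right_idempotent_reflexive (skew_poly sigma) <->
      right_idempotent_reflexive (skew_series sigma))) /\
  ((left_idempotent_reflexive R <->
      left_idempotent_reflexive (skew_poly sigma)) /\
   (left_idempotent_reflexive (skew_poly sigma) <->
      left_idempotent_reflexive (skew_series sigma))) /\
  ((idempotent_reflexive R <->
      idempotent_reflexive (skew_poly sigma)) /\
   (idempotent_reflexive (skew_poly sigma) <->
      idempotent_reflexive (skew_series sigma))).
Proof.
have r1 := right_reflexive_series Rsigma.
have r2 := @right_reflexive_series_poly R sigma.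
have r3 := right_reflexive_poly_base Rsigma.
have l1 := left_reflexive_series Rsigma.
have l2 := @left_reflexive_series_poly R sigma.
have l3 := left_reflexive_poly_base Rsigma.
rewrite /idempotent_reflexive; tauto.
Qed.
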